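(* Let $n\ge2$. There is a constant $C_n$ depending only on $n$ such that for any integer $M=1,2,\dots$ there exists a $2^{-M}$-simple function $V:[1,2)\to\mathbb{R}^n$ such that $$\Big|\bigcup_{\alpha\in[1,2)}\big(S_\alpha+V(\alpha)\big)\Big|\le\frac{C_n}{M},$$ where $S_\alpha=\{X\in\mathbb{R}^n:|X|=\alpha\}$.
   Context: A function $V=(v_1,\dots,v_n):[1,2)\to\mathbb{R}^n$ is $\frac1N$-simple ($N$ a positive integer) if each component $v_k$ is constant on each interval $[1+\frac iN,1+\frac{i+1}N)$, $i=0,\dots,N-1$. $|\cdot|$ of a set denotes Lebesgue measure. *)

(* Defs.v *)
From HB Require Import structures.
From mathcomp Require Import all_boot all_order all_algebra.
From mathcomp Require Import all_classical all_reals all_analysis.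

Set Implicit Arguments.
Unset Strict Implicit.
Unset Printing Implicit Defensive.

Import Order.TTheory GRing.Theory Num.Theory.
Import numFieldNormedType.Exports.

Local Open Scope classical_set_scope.
Local Open Scope ring_scope.

Section cons_measure.
Context {R : realType} {n : nat}.
Local Notation Rm := (measurableTypeR R).

Definition cons_pair (p : Rm * n.-tuple Rm) : n.+1.-tuple Rm :=
  [the n.+1.-tuple Rm of p.1 :: p.2].

Lemma measurable_cons_pair : measurable_fun [set: Rm * n.-tuple Rm] cons_pair.
Proof. exact: measurable_cons. Qed.

Variable m : {sigma_finite_measure set (n.-tuple Rm) -> \bar R}.

Definition cons_measure : set (n.+1.-tuple Rm) -> \bar R :=
  pushforward (lebesgue_measure \x m)%E cons_pair.

Let cons_measure0 : cons_measure set0 = 0%E.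
Proof. by rewrite /cons_measure /pushforward preimage_set0 measure0. Qed.

Let cons_measure_ge0 A : (0 <= cons_measure A)%E.
Proof. by rewrite /cons_measure /pushforward measure_ge0. Qed.

Let cons_measure_sigma_additive : semi_sigma_additive cons_measure.
Proof.
move=> F mF tF mUF; rewrite /cons_measure /pushforward preimage_bigcup.
apply: measure_semi_sigma_additive.
- by move=> k; rewrite -[X in measurable X]setTI; exact: measurable_cons_pair.
- apply/trivIsetP => /= i j _ _ ij; rewrite -preimage_setI.
  by move/trivIsetP : tF => /(_ _ _ _ _ ij) ->//; rewrite preimage_set0.
- by rewrite -preimage_bigcup -[X in measurable X]setTI;
    exact: measurable_cons_pair.
Qed.

HB.instance Definition _ := isMeasure.Build _ _ _ cons_measure
  cons_measure0 cons_measure_ge0 cons_measure_sigma_additive.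

Let uncons (t : n.+1.-tuple Rm) : Rm * n.-tuple Rm :=
  (thead t, [tuple of behead t]).

Let measurable_uncons : measurable_fun setT uncons.
Proof.
apply/measurable_fun_pair; first exact: measurable_tnth.
exact: measurable_behead.
Qed.

Let cons_pairK : cancel cons_pair uncons.
Proof. by case=> x t; congr (_, _); apply/val_inj. Qed.

Let cons_measure_sigma_finite : sigma_finite setT cons_measure.
Proof.
have /sigma_finiteP[F [TF ndF Foo]] := sigma_finiteT (@lebesgue_measure R).
have /sigma_finiteP[G [TG ndG Goo]] := sigma_finiteT m.
exists (fun k => uncons @^-1` (F k `*` G k)) => [|k].
  rewrite -preimage_bigcup -[LHS](preimage_setT uncons); congr (_ @^-1` _).
  rewrite -setXTT TF TG predeqE => -[x y]; split.
    move=> [/= [i _ Fix] [k _ Gky]]; exists (maxn i k) => //; split.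
    - by move: x Fix; exact/subsetPset/ndF/leq_maxl.
    - by move: y Gky; exact/subsetPset/ndG/leq_maxr.
  by move=> [i _ []/= ? ?]; split; exists i.
have [mF Fk] := Foo k; have [mG Gk] := Goo k; split.
  rewrite -[X in measurable X]setTI; apply: measurable_uncons => //.
  exact: measurableX.
rewrite /cons_measure /pushforward -comp_preimage.
rewrite (_ : uncons \o cons_pair = id); last first.
  by apply/funext => p; exact: cons_pairK.
by rewrite preimage_id product_measure1E// lte_mul_pinfty// ge0_fin_numE.
Qed.

HB.instance Definition _ := Measure_isSigmaFinite.Build _ _ _ cons_measure
  cons_measure_sigma_finite.

End cons_measure.

(* Lebesgue measure on (the Borel sets of) R^n, as the n-fold product of the
   one-dimensional one; see lebesgue_tuple_box and vol_box. *)
Fixpoint lebesgue_tuple {R : realType} (n : nat) :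
    {sigma_finite_measure set (n.-tuple (measurableTypeR R)) -> \bar R} :=
  if n is n'.+1 then cons_measure (lebesgue_tuple n')
  else \d_ [tuple].

Lemma lebesgue_tuple_box (R : realType) (n : nat)
    (A : 'I_n -> set (measurableTypeR R)) :
  (forall i, measurable (A i)) ->
  lebesgue_tuple n [set t | forall i, A i (tnth t i)] =
  (\prod_(i < n) lebesgue_measure (A i))%E.
Proof.
elim: n A => [|n IHn] A mA.
  rewrite big_ord0 /= diracE mem_set//; by case.
rewrite big_ord_recl /= /cons_measure /pushforward.
set B := [set t : n.-tuple _ | forall i, A (lift ord0 i) (tnth t i)].
have -> : cons_pair @^-1` [set t | forall i, A i (tnth t i)] = A ord0 `*` B.
  apply/seteqP; split=> [[x t] /= h|[x t] /= [h0 h] i].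
    by split=> [|i]; [exact: (h ord0)|have := h (lift ord0 i); rewrite tnthS].
  by have [j ->|->] := unliftP ord0 i; [rewrite tnthS; exact: h|].
rewrite product_measure1E//; first by congr (_ * _)%E; exact: IHn.
rewrite (_ : B = \bigcap_(i in [set: 'I_n])
    ((fun t => tnth t i) @^-1` A (lift ord0 i))); last first.
  by apply/seteqP; split=> t h i; [move=> _; exact: h|exact: (h i I)].
apply: fin_bigcap_measurable => // i _.
by rewrite -[X in measurable X]setTI; exact: measurable_tnth.
Qed.

Definition vol {R : realType} {n : nat} (A : set 'rV[R]_n) : \bar R :=
  lebesgue_tuple n [set t | A (\row_i tnth t i)].

Lemma vol_box (R : realType) (n : nat) (A : 'I_n -> set (measurableTypeR R)) :
  (forall i, measurable (A i)) ->
  vol [set X : 'rV[R]_n | forall i, A i (X 0 i)] =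
  (\prod_(i < n) lebesgue_measure (A i))%E.
Proof.
move=> mA; rewrite -lebesgue_tuple_box//; congr (lebesgue_tuple n _).
by apply/seteqP; split=> t /= h i; have := h i; rewrite mxE.
Qed.

(* The library norm `|X| on 'rV[R]_n is the sup norm. *)
Definition l2norm {R : realType} {n : nat} (X : 'rV[R]_n) : R :=
  Num.sqrt (\sum_(i < n) X 0 i ^+ 2).

Definition l2sphere {R : realType} {n : nat} (a : R) : set 'rV[R]_n :=
  [set X | l2norm X = a].

Definition translate {R : realType} {n : nat} (A : set 'rV[R]_n)
    (v : 'rV[R]_n) : set 'rV[R]_n := [set X + v | X in A].

(* Functions [1, 2) -> R^n are represented by total ones, whose values outside
   [1, 2) are irrelevant. *)
Definition is_simple {R : realType} {n : nat} (N : nat) (V : R -> 'rV[R]_n) :=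
  forall (k : 'I_n) (i : 'I_N), exists c : R,
    forall a, a \in `[1 + i%:R / N%:R, 1 + i.+1%:R / N%:R[ -> V a 0 k = c.

(* Main.v *)
Require Import Defs.
From mathcomp Require Import all_boot all_order all_algebra.
From mathcomp Require Import all_classical all_reals all_analysis.
From mathcomp Require Import measurable_realfun ring lra.
Import Order.TTheory GRing.Theory Num.Theory.
Import numFieldNormedType.Exports.
Set Implicit Arguments.
Unset Strict Implicit.
Unset Printing Implicit Defensive.
Local Open Scope classical_set_scope.
Local Open Scope ring_scope.

(** Write [a = 1 + sum_j d_j] with binary digits [d_j] in [{0, 2^-(j+1)}] and put
    [V a = sum_(j < M) d_j c_j], where the vectors [c_j] move slowly, in steps of
    size [O(1/M)].  In the direction [th], the digit [d_j] moves the sphere along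
    its normal by [d_j (1 + th . c_j)].  The path [c] starts at [0] and visits
    large multiples of all [e_i] and [- e_i], so that for each unit vector [th]
    some factor [1 + th . c_k] is [O(1/M)], and the following ones are
    [O((j-k+1)/M)].  Hence the points in direction [th] of all spheres sharing
    the first [k] digits lie in one shell of thickness [O(h)], [h = 2^-k / M],
    and in the slab [|a_k + c_k . Y| = O(1/M)].  Shell and slab are transversal,
    so their intersection is covered by cubes of side [O(h)] of total volume
    [O(h/M)]; there are [2^k] choices of the first digits and [O(M)] choices of
    [k], whence the bound [O(1/M)].  Starting the path only at [j = M/2] makes
    the curvature errors [O(4^-k)] negligible. *)

(** * Sup norm and inner product of row vectors *)

Lemma norm_row_leP (R : realType) (n : nat) (X : 'rV[R]_n) (r : R) :
  0 <= r -> reflect (forall i, `|X 0 i| <= r) (`|X| <= r).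
Proof.
move=> r0; rewrite [`|X|]mx_normrE; apply: (iffP idP) => [/bigmax_leP[_ h] i|h].
  exact: (h (0, i)).
by apply/bigmax_leP; split=> // -[i j] _ /=; rewrite ord1.
Qed.

Lemma norm_coord_le (R : realType) (n : nat) (X : 'rV[R]_n) i :
  `|X 0 i| <= `|X|.
Proof. exact/norm_row_leP. Qed.

Section Dot.
Context {R : realType} {n : nat}.
Implicit Types x y z : 'rV[R]_n.

Definition dot x y : R := \sum_i x 0 i * y 0 i.

Lemma dotC x y : dot x y = dot y x.
Proof. by apply: eq_bigr => i _; rewrite mulrC. Qed.

Lemma dotDl x y z : dot (x + y) z = dot x z + dot y z.
Proof. by rewrite -big_split; apply: eq_bigr => i _; rewrite mxE mulrDl. Qed.

Lemma dotZl a x y : dot (a *: x) y = a * dot x y.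
Proof. by rewrite mulr_sumr; apply: eq_bigr => i _; rewrite mxE mulrA. Qed.

Lemma dotNl x y : dot (- x) y = - dot x y.
Proof. by rewrite -scaleN1r dotZl mulN1r. Qed.

Lemma dotDr x y z : dot x (y + z) = dot x y + dot x z.
Proof. by rewrite dotC dotDl !(dotC x). Qed.

Lemma dotZr a x y : dot x (a *: y) = a * dot x y.
Proof. by rewrite dotC dotZl dotC. Qed.

Lemma dotNr x y : dot x (- y) = - dot x y.
Proof. by rewrite dotC dotNl dotC. Qed.

Lemma dot0r x : dot x 0 = 0.
Proof. by rewrite -(scale0r 0) dotZr mul0r. Qed.

Lemma dot_sumr x (I : Type) (r : seq I) (P : pred I) (F : I -> 'rV[R]_n) :
  dot x (\sum_(i <- r | P i) F i) = \sum_(i <- r | P i) dot x (F i).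
Proof. by elim/big_rec2: _ => [|i u v _ <-]; rewrite ?dot0r ?dotDr. Qed.

Lemma norm_dot_le x y : `|dot x y| <= n%:R * `|x| * `|y|.
Proof.
apply: le_trans (ler_norm_sum _ _ _) _.
rewrite -mulrA mulr_natl -[X in _ <= _ *+ X]card_ord -sumr_const.
by apply: ler_sum => i _; rewrite normrM ler_pM ?norm_coord_le.
Qed.

Lemma l2normE x : l2norm x = Num.sqrt (dot x x).
Proof. by congr (Num.sqrt _); apply: eq_bigr => i _; rewrite expr2. Qed.

Lemma dotxx_ge0 x : 0 <= dot x x.
Proof. by apply: sumr_ge0 => i _; rewrite -expr2 sqr_ge0. Qed.

Lemma sqr_coord_le_dot x i : x 0 i ^+ 2 <= dot x x.
Proof.
rewrite /dot (bigD1 i)//= -expr2 lerDl.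
by apply: sumr_ge0 => j _; rewrite -expr2 sqr_ge0.
Qed.

Lemma norm_le_dot x r : 0 <= r -> dot x x <= r ^+ 2 -> `|x| <= r.
Proof.
move=> r0 xr; apply/norm_row_leP => // i.
by rewrite -ler_sqr ?nnegrE// real_normK ?num_real// (le_trans (sqr_coord_le_dot _ _)).
Qed.

End Dot.

(** * Finite coverings by cubes *)

Section BoxCover.
Context {R : realType} {n : nat}.
Implicit Types (A B : set 'rV[R]_n) (v w h d : R).

(** A pair is the center and the half side of a cube, that is, of a sup-norm ball. Covers make sense
    for arbitrary sets, so measurability enters only when a cover is turned into a volume bound. *)
Definition box_cover A v := exists s : seq ('rV[R]_n * R),
  [/\ forall p, p \in s -> 0 <= p.2,
      forall X, A X -> exists2 p, p \in s & `|X - p.1| <= p.2 &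
      \sum_(p <- s) (2 * p.2) ^+ n <= v].

Lemma box_cover_le A B v w : A `<=` B -> v <= w -> box_cover B v -> box_cover A w.
Proof.
move=> AB vw [s [s0 sB sv]]; exists s; split=> //; last exact: le_trans vw.
by move=> X /AB; exact: sB.
Qed.

Lemma box_cover_union (T : finType) (F : T -> set 'rV[R]_n) A v :
  (forall t, box_cover (F t) v) -> (forall X, A X -> exists t, F t X) ->
  box_cover A (#|T|%:R * v).
Proof.
move=> /choice[s sP] AF; exists (flatten [seq s t | t <- enum T]); split.
- by move=> p /flatten_mapP[t _ pt]; have [h _ _] := sP t; exact: h.
- move=> X /AF[t tX]; have [_ /(_ X tX)[p pt Xp] _] := sP t.
  by exists p => //; apply/flatten_mapP; exists t => //; rewrite mem_enum.
- rewrite big_flatten big_map big_enum/= mulr_natl -sumr_const.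
  by apply: ler_sum => t _; case: (sP t).
Qed.

Lemma box_cover_diam A d : 0 <= d ->
  (forall X Y, A X -> A Y -> `|X - Y| <= d) -> box_cover A ((2 * d) ^+ n).
Proof.
move=> d0 dA; have [->|/set0P[X AX]] := eqVneq A set0.
  by exists [::]; split=> //; rewrite big_nil exprn_ge0// mulr_ge0.
exists [:: (X, d)]; split; rewrite ?big_seq1//.
- by move=> p /[!inE]/eqP->.
- by move=> Y AY; exists (X, d); rewrite ?inE//=; exact: dA.
Qed.

(** The values of [f] lie in an interval of length [2 * l]; slicing it into layers of width [h] cuts
    [A] into at most [2 * l / h + 1] pieces. *)
Lemma box_cover_split (f : 'rV[R]_n -> R) (a l : R) A v h : 0 < h -> 0 <= l -> 0 <= v ->
  (forall X, A X -> `|f X - a| <= l) ->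
  (forall B, B `<=` A -> (forall X Y, B X -> B Y -> `|f X - f Y| <= h) ->
    box_cover B v) ->
  box_cover A ((2 * l / h + 1) * v).
Proof.
move=> h0 l0 v0 fA AB; set g := fun X => Num.truncn ((f X - a + l) / h).
set N := (Num.truncn (2 * l / h)).+1.
have g0 X : A X -> 0 <= (f X - a + l) / h.
  by move=> /fA /[!ler_norml]/andP[? ?]; rewrite divr_ge0 ?(ltW h0)//; lra.
have lh0 : 0 <= 2 * l / h by rewrite divr_ge0 ?mulr_ge0// ltW.
apply: (@box_cover_le _ A (#|'I_N|%:R * v)) => //.
  by rewrite card_ord ler_wpM2r// /N -[leLHS]natr1 lerD2r truncn_le.
apply: (@box_cover_union 'I_N (fun t : 'I_N => [set X | A X /\ g X = t])).
  move=> t; apply: AB => [X []//|X Y [AX Xt] [AY Yt]].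
  have := truncn_itv (g0 _ AX); have := truncn_itv (g0 _ AY).
  rewrite -/(g X) -/(g Y) Xt Yt !ler_pdivlMr// !ltr_pdivrMr// -natr1.
  by move=> /andP[? ?] /andP[? ?]; rewrite ler_norml; apply/andP; split; lra.
move=> X AX; have gN : (g X < N)%N.
  rewrite ltnS le_truncn// ler_pM2r ?invr_gt0//.
  by have /[!ler_norml]/andP[? ?] := fA _ AX; lra.
by exists (Ordinal gN).
Qed.

Lemma box_cover_split_coords (r : seq 'I_n) (W : 'rV[R]_n) (l : R) A v h :
  0 < h -> 0 <= l -> 0 <= v ->
  (forall X, A X -> `|X - W| <= l) ->
  (forall B, B `<=` A ->
    (forall i X Y, i \in r -> B X -> B Y -> `|X 0 i - Y 0 i| <= h) ->
    box_cover B v) ->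
  box_cover A ((2 * l / h + 1) ^+ size r * v).
Proof.
move=> h0 l0 v0; elim: r A => [|i r IH] A AW AB.
  by rewrite expr0 mul1r; exact: AB.
rewrite exprS -mulrA; apply: (@box_cover_split (fun X => X 0 i) (W 0 i)) => //.
- rewrite mulr_ge0// exprn_ge0// addr_ge0// divr_ge0 ?mulr_ge0//; exact: ltW.
- by move=> X /AW; have := norm_coord_le (X - W) i; rewrite !mxE; exact: le_trans.
- move=> B BA Bi; apply: IH => [X /BA/AW//|B' B'B B'r].
  apply: AB => [X /B'B/BA//|k X Y /[!inE]/orP[/eqP->|kr] BX BY].
  + by apply: Bi; exact: B'B.
  + exact: B'r.
Qed.

End BoxCover.

(** Subadditivity of the measure, with the product formula for each cube; measurability of [A] gives
    monotonicity. *)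
Lemma vol_le_box_cover (R : realType) (n : nat) (A : set 'rV[R]_n) (v : R) :
  measurable [set t : n.-tuple (measurableTypeR R) | A (\row_i tnth t i)] ->
  box_cover A v -> (vol A <= v%:E)%E.
Proof.
move=> mA [s [s0 sA sv]].
pose J (p : 'rV[R]_n * R) i : set (measurableTypeR R) :=
  [set` `[p.1 0 i - p.2, p.1 0 i + p.2]].
have mJ p i : measurable (J p i) by exact: measurable_itv.
pose F p := [set t : n.-tuple (measurableTypeR R) | forall i, J p i (tnth t i)].
have mF p : measurable (F p).
  rewrite (_ : F p = \bigcap_(i in [set: 'I_n]) ((fun t => tnth t i) @^-1` J p i)).
    apply: fin_bigcap_measurable => // i _.
    by rewrite -[X in measurable X]setTI; exact: measurable_tnth.
  by apply/seteqP; split=> t h i; [move=> _; exact: h|exact: (h i I)].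
have volF p : 0 <= p.2 -> lebesgue_tuple n (F p) = ((2 * p.2) ^+ n)%:E.
  move=> p0; rewrite lebesgue_tuple_box//.
  rewrite (eq_bigr (fun=> (2 * p.2)%:E)) => [|i _].
    by rewrite prodEFin prodr_const card_ord.
  rewrite lebesgue_measure_itv/= lte_fin.
  (* In the second case the radius is [0] and the degenerate interval has length [0]. *)
  case: ltP => h; first by rewrite -EFinB; congr EFin; ring.
  by congr EFin; lra.
have mU (r : seq ('rV[R]_n * R)) : measurable (\big[setU/set0]_(p <- r) F p).
  by elim/big_rec: _ => // p B _ mB; exact: measurableU.
apply: (@le_trans _ _ (lebesgue_tuple n (\big[setU/set0]_(p <- s) F p))).
  apply: le_measure; rewrite ?inE// => t /= /sA[p ps tp].
  rewrite (big_rem p)//=; left=> i; rewrite /J /= in_itv /=.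
  have /norm_row_leP := tp => /(_ (s0 _ ps) i).
  by rewrite !mxE ler_norml => /andP[? ?]; apply/andP; split; lra.
apply: le_trans (_ : _ <= (\sum_(p <- s) (2 * p.2) ^+ n)%:E)%E _; last first.
  by rewrite lee_fin.
elim: s s0 {sA sv} => [_|p s IH s0]; first by rewrite !big_nil measure0.
rewrite !big_cons EFinD -volF; last by apply: s0; rewrite mem_head.
apply: le_trans (measureU2 _ _ _) _ => //; rewrite leeD2l// IH// => q qs.
by apply: s0; rewrite inE qs orbT.
Qed.

(** * Transversal intersection of a shell and a slab *)

Definition minor (R : realType) (n : nat) (i j : 'I_n) (x y : 'rV[R]_n) : R :=
  x 0 i * y 0 j - x 0 j * y 0 i.

Section SlabShell.
Context {R : realType} {n : nat}.
Variables (C B : R).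

(** A shell of center [W] and radius [a], of thickness of order [h], cut by a slab normal to [c] of
    thickness of order [eta]. The third condition is transversality in the plane of the coordinates
    [i] and [j]; with the sign [s] fixed, the minors of two points add up without cancellation. *)
Definition slab_shell (W c : 'rV[R]_n) (i j : 'I_n) (s a eta h : R) :
    set 'rV[R]_n := [set X |
  [/\ `|dot (X - W) (X - W) - a ^+ 2| <= C * h, `|a + dot c (X - W)| <= C * eta,
      2^-1 <= s * minor i j (X - W) c & `|X - W| <= B]].

(** The first two terms come from Cramer's rule for the coordinates [i] and [j]; the [1] serves the
    remaining coordinates. *)
Definition slab_shell_diam : R := B * (2 * C + n%:R * (2 * B)) + 2 * B + 1.

(* The increments of [X |-> |X|^2] and [X |-> c . X] form a 2 x 2 linear system
   for the coordinates [i] and [j] of [X - Y], whose determinant is bounded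
   below because the two minors have the same sign. *)
Lemma slab_shell_close (W c : 'rV[R]_n) (i j : 'I_n) (s a eta h : R) X Y :
  1 <= C -> 1 <= B -> i != j -> `|s| = 1 -> `|c| <= B -> 0 <= h ->
  (forall l, l != i -> l != j -> c 0 l = 0) ->
  slab_shell W c i j s a eta h X -> slab_shell W c i j s a eta h Y ->
  `|dot c X - dot c Y| <= h ->
  (forall l, l != i -> l != j -> `|X 0 l - Y 0 l| <= h) ->
  `|X - Y| <= slab_shell_diam * h.
Proof.
move=> C1 B1 ij s1 cB h0 c0 [XC _ Xs XB] [YC _ Ys YB] cXY lXY.
have B0 : 0 <= B by lra.
have C0 : 0 <= C by lra.
set D := X - Y; set S := (X - W) + (Y - W).
have SB : `|S| <= 2 * B by apply: le_trans (ler_normD _ _) _; lra.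
have DS : `|dot D S| <= 2 * C * h.
  (* The difference of the two squared distances to [W] factors as [dot D S]. *)
  have -> : dot D S = (dot (X - W) (X - W) - a ^+ 2) - (dot (Y - W) (Y - W) - a ^+ 2).
    have -> : D = (X - W) - (Y - W) by rewrite /D opprB addrA subrK.
    by rewrite /S !(dotDl, dotDr, dotNl, dotNr) (dotC Y X) (dotC W X) (dotC W Y); ring.
  by apply: le_trans (ler_normB _ _) _; lra.
have cD : `|dot c D| <= h by rewrite /D dotDr dotNr.
have split2 (x y : 'rV[R]_n) : dot x y = x 0 i * y 0 i + x 0 j * y 0 j +
    \sum_(l | (l != i) && (l != j)) x 0 l * y 0 l.
  by rewrite /dot (bigD1 i)//= (bigD1 j) 1?eq_sym//= addrA.
have cDij : dot c D = c 0 i * D 0 i + c 0 j * D 0 j.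
  by rewrite split2 big1 ?addr0// => l /andP[li lj]; rewrite c0// mul0r.
have DSij : `|D 0 i * S 0 i + D 0 j * S 0 j| <= (2 * C + n%:R * (2 * B)) * h.
  have := split2 D S; set r := (X in _ = _ + X) => DSr.
  have rB : `|r| <= n%:R * (2 * B * h).
    apply: le_trans (ler_norm_sum _ _ _) _.
    apply: le_trans (_ : _ <= \sum_(l | (l != i) && (l != j)) 2 * B * h) _.
      apply: ler_sum => l /andP[li lj]; rewrite normrM mulrC ler_pM//.
        exact: le_trans (norm_coord_le _ _) SB.
      by rewrite /D !mxE lXY.
    rewrite sumr_const -[leLHS]mulr_natl ler_wpM2r ?mulr_ge0//.
    by rewrite ler_nat -[leqRHS]card_ord max_card.
  have -> : D 0 i * S 0 i + D 0 j * S 0 j = dot D S - r by rewrite DSr addrK.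
  by apply: le_trans (ler_normB _ _) _; lra.
pose Det := S 0 i * c 0 j - S 0 j * c 0 i.
have Det1 : 1 <= `|Det|.
  have -> : `|Det| = `|s * Det| by rewrite normrM s1 mul1r.
  have -> : s * Det = s * minor i j (X - W) c + s * minor i j (Y - W) c.
    by rewrite /Det /S /minor !mxE; ring.
  by apply: le_trans (ler_norm _); lra.
have key (u : R) : `|u * Det| <= B * ((2 * C + n%:R * (2 * B)) * h) + 2 * B * h ->
    `|u| <= slab_shell_diam * h.
  move=> uD; apply: le_trans (_ : _ <= `|u * Det|) _.
    by rewrite normrM ler_peMr.
  by apply: le_trans uD _; rewrite /slab_shell_diam; lra.
have cB' l : `|c 0 l| <= B by exact: le_trans (norm_coord_le _ _) cB.
have SB' l : `|S 0 l| <= 2 * B by exact: le_trans (norm_coord_le _ _) SB.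
have dd0 : 1 <= slab_shell_diam.
  by rewrite /slab_shell_diam lerDr !(addr_ge0, mulr_ge0).
apply/norm_row_leP => [|l]; first by rewrite mulr_ge0//; lra.
have [->|li] := eqVneq l i.
  apply: key.
  have -> : D 0 i * Det = c 0 j * (D 0 i * S 0 i + D 0 j * S 0 j) - S 0 j * dot c D.
    by rewrite cDij /Det; ring.
  by apply: le_trans (ler_normB _ _) _; rewrite !normrM lerD// ler_pM.
have [->|lj] := eqVneq l j.
  apply: key.
  have -> : D 0 j * Det = S 0 i * dot c D - c 0 i * (D 0 i * S 0 i + D 0 j * S 0 j).
    by rewrite cDij /Det; ring.
  by apply: le_trans (ler_normB _ _) _; rewrite !normrM addrC lerD// ler_pM.
rewrite /D !mxE; apply: le_trans (lXY _ li lj) _.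
by rewrite ler_peMl.
Qed.

(** Slicing along [dot c] gives about [eta / h] layers, and slicing along the n - 2 coordinates
    other than [i] and [j] gives about h^(2-n) pieces of each. By [slab_shell_close] every piece has
    diameter O(h), so the total volume is of order (eta / h) h^(2-n) h^n = eta h. *)
Lemma box_cover_slab_shell (W c : 'rV[R]_n) (i j : 'I_n) (s a eta h : R) :
  1 <= C -> 1 <= B -> i != j -> `|s| = 1 -> `|c| <= B -> 0 < h -> h <= eta -> eta <= 1 ->
  (forall l, l != i -> l != j -> c 0 l = 0) ->
  box_cover (slab_shell W c i j s a eta h)
    ((2 * C + 1) * (2 * B + 1) ^+ n * (2 * slab_shell_diam) ^+ n * (eta * h)).
Proof.
move=> C1 B1 ij s1 cB h0 heta eta1 c0.
have B0 : 0 <= B by lra.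
have C0 : 0 <= C by lra.
have eta0 : 0 < eta by apply: lt_le_trans heta.
have dd0 : 0 <= slab_shell_diam.
  by rewrite /slab_shell_diam !(addr_ge0, mulr_ge0).
pose r := enum (~: [set i; j]).
have n2 : n = (size r).+2.
  by rewrite -cardE -[LHS](card_ord n) -(cardsC [set i; j]) cards2 ij.
set v := (2 * (slab_shell_diam * h)) ^+ n.
have v0 : 0 <= v by rewrite exprn_ge0// !mulr_ge0// ltW.
set q := 2 * B / h + 1.
have q0 : 0 <= q by rewrite addr_ge0// divr_ge0 ?(ltW h0)// mulr_ge0.
apply: (@box_cover_le _ _ _ (slab_shell W c i j s a eta h)
  ((2 * (C * eta) / h + 1) * (q ^+ size r * v))) => //.
  have -> : (2 * C + 1) * (2 * B + 1) ^+ n * (2 * slab_shell_diam) ^+ n * (eta * h)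
     = ((2 * C + 1) * (eta / h)) * ((2 * B + 1) ^+ n * h ^+ 2 * (2 * slab_shell_diam) ^+ n).
    by field; rewrite gt_eqF.
  apply: ler_pM.
  - by rewrite addr_ge0// divr_ge0 ?(ltW h0)// !mulr_ge0 ?(ltW eta0)//; lra.
  - by rewrite mulr_ge0// exprn_ge0.
  - have : 1 <= eta / h by rewrite ler_pdivlMr// mul1r.
    by rewrite -!mulrA; lra.
  - have -> : q ^+ size r * v = (h * q) ^+ size r * h ^+ 2 * (2 * slab_shell_diam) ^+ n.
      have hn : h ^+ n = h ^+ size r * h ^+ 2 by rewrite -exprD addn2 -n2.
      rewrite /v mulrA exprMn hn [(h * q) ^+ _]exprMn.
      by move: (_ ^+ n) (h ^+ size r) (q ^+ size r) => x y z; ring.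
    rewrite ler_wpM2r ?exprn_ge0 ?mulr_ge0// ler_wpM2r ?exprn_ge0 ?(ltW h0)//.
    apply: le_trans (_ : (2 * B + 1) ^+ size r <= _); last first.
      by apply: ler_weXn2l; [lra|rewrite [leqRHS]n2 -addn2 leq_addr].
    have hq : h * q <= 2 * B + 1.
      by rewrite /q mulrDr mulr1 mulrC divfK ?gt_eqF//; lra.
    have hq0 : 0 <= h * q by rewrite mulr_ge0// ltW.
    by apply: lerXn2r; rewrite ?nnegrE//; lra.
apply: (@box_cover_split _ _ (dot c) (dot c W - a)) => //.
- by rewrite mulr_ge0 ?(ltW eta0)//; lra.
- by rewrite mulr_ge0// exprn_ge0.
- move=> X [_ Xa _ _]; move: Xa; rewrite dotDr dotNr.
  by have -> : a + (dot c X - dot c W) = dot c X - (dot c W - a) by ring.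
move=> A AS Ac; apply: (@box_cover_split_coords _ _ r W) => //.
  by move=> X /AS[].
move=> A' A'A A'r; apply: box_cover_diam.
  by rewrite mulr_ge0// ltW.
move=> X Y AX AY; apply: (@slab_shell_close W c i j s a eta) => //.
- exact: ltW.
- exact/AS/A'A.
- exact/AS/A'A.
- by apply: Ac; exact: A'A.
- by move=> l li lj; apply: A'r => //; rewrite mem_enum !inE negb_or li lj.
Qed.

End SlabShell.

(** * Binary truncation and geometric sums *)

Section Dyadic.
Context {R : realType}.
Implicit Types (a : R) (j k m : nat).

(** Truncation of [a] to [j] binary digits after the point; the digit d_j of the overview is
    [dyad j.+1 a - dyad j a]. *)
Definition dyad j a : R := 1 + (Num.truncn (2 ^+ j * (a - 1)))%:R / 2 ^+ j.

Let pow2_gt0 k : 0 < 2 ^+ k :> R. Proof. by rewrite exprn_gt0. Qed.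

Lemma dyad_le j a : 1 <= a -> dyad j a <= a.
Proof.
move=> a1; rewrite /dyad -lerBrDl ler_pdivrMr// mulrC truncn_le.
by rewrite mulr_ge0 ?subr_ge0// ltW.
Qed.

Lemma dyad_gt j a : 1 <= a -> a < dyad j a + 2 ^- j.
Proof.
move=> a1; rewrite /dyad -addrA -ltrBlDl -[X in _ < _ + X]mul1r -mulrDl ltr_pdivlMr//.
rewrite mulrC natr1; have /truncn_itv/andP[]// : 0 <= 2 ^+ j * (a - 1).
by rewrite mulr_ge0 ?subr_ge0// ltW.
Qed.

Lemma dyad_eq j a (q : nat) :
  1 + q%:R / 2 ^+ j <= a < 1 + q.+1%:R / 2 ^+ j -> dyad j a = 1 + q%:R / 2 ^+ j.
Proof.
move=> /andP[qa aq]; congr (1 + _%:R / _); apply: truncn_def.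
by rewrite mulrC -ler_pdivrMr// lerBrDl qa -ltr_pdivlMr// ltrBlDl.
Qed.

Lemma dyad_dyad j k a : (j <= k)%N -> 1 <= a -> dyad j (dyad k a) = dyad j a.
Proof.
move=> jk a1; apply: dyad_eq; apply/andP; split; last first.
  apply: le_lt_trans (dyad_le k a1) _; apply: lt_le_trans (dyad_gt j a1) _.
  by rewrite /dyad -addrA -[(Num.truncn _).+1%:R]natr1 mulrDl mul1r.
have a0 : 0 <= a - 1 by rewrite subr_ge0.
rewrite /dyad lerD2l ler_pdivrMr// mulrAC ler_pdivlMr//.
set p := Num.truncn _; set q := Num.truncn _.
(* The left side is an integer at most [2 ^+ k * (a - 1)], hence at most its integer part [q]. *)
have pq : (p * 2 ^ (k - j) <= q)%N.
  rewrite truncn_ge_nat ?mulr_ge0 ?(ltW (pow2_gt0 _))// natrM natrX.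
  rewrite -{2}(subnKC jk) exprD mulrAC ler_pM2r// truncn_le.
  by rewrite mulr_ge0 ?(ltW (pow2_gt0 _)).
rewrite -{1}(subnK jk) exprD mulrA ler_pM2r//.
by rewrite -natrX -natrM ler_nat.
Qed.

(** Both truncations lie within [2 ^- j] below [a]. This loses a factor 2 against the true size of a
    digit, which only affects constants. *)
Lemma dyad_diff j a : 1 <= a -> `|dyad j.+1 a - dyad j a| <= 2 ^- j.
Proof.
move=> a1; have := dyad_le j a1; have := dyad_gt j a1.
have := dyad_le j.+1 a1; have := dyad_gt j.+1 a1.
have : 2 ^- j.+1 <= 2 ^- j :> R by rewrite lef_pV2 ?posrE// ler_weXn2l// ler1n.
by rewrite ler_norml => *; apply/andP; split; lra.
Qed.

Lemma dyad_index j a : 1 <= a < 2 -> exists q : 'I_(2 ^ j), dyad j a = 1 + q%:R / 2 ^+ j.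
Proof.
move=> /andP[a1 a2].
have q2 : (Num.truncn (2 ^+ j * (a - 1)) < 2 ^ j)%N.
  rewrite truncn_lt_nat ?mulr_ge0 ?subr_ge0 ?(ltW (pow2_gt0 _))//.
  by rewrite natrX gtr_pMr//; lra.
by exists (Ordinal q2).
Qed.

Lemma sum_inv_pow2 k m : \sum_(k <= j < k + m) 2 ^- j <= 2 * 2 ^- k :> R.
Proof.
suff -> : \sum_(k <= j < k + m) 2 ^- j = 2 ^- k * (2 - 2 * 2 ^- m) :> R.
  have : 0 < 2 ^- k * 2 ^- m :> R by rewrite mulr_gt0 ?invr_gt0.
  by lra.
elim: m => [|m IH]; first by rewrite addn0 big_geq// expr0; field.
rewrite addnS big_nat_recr ?leq_addr//= IH exprD exprS.
by field; rewrite !gt_eqF.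
Qed.

(** The sum has a closed form, proved by induction. The separate last term accounts for the part of
    [a] beyond its last digit in [shift_tail_dot_le]. *)
Lemma sum_inv_pow2_linear k m :
  \sum_(k <= j < k + m) 2 ^- j * (j - k).+1%:R + 2 ^- (k + m) * m.+1%:R
  <= 4 * 2 ^- k :> R.
Proof.
suff -> : \sum_(k <= j < k + m) 2 ^- j * (j - k).+1%:R =
    2 ^- k * (4 - (2 * m%:R + 4) * 2 ^- m) :> R.
  have : 0 <= 2 ^- k * 2 ^- m * (m%:R + 3) :> R.
    by rewrite !mulr_ge0 ?invr_ge0 ?(ltW (pow2_gt0 _))// addr_ge0.
  by rewrite exprD invfM -natr1; lra.
elim: m => [|m IH]; first by rewrite addn0 big_geq// expr0; field.
rewrite addnS big_nat_recr ?leq_addr//= IH exprD exprS addKn -natr1.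
by field; rewrite !gt_eqF.
Qed.

End Dyadic.

(** * The translation vectors *)

Section Translations.
Context {R : realType} {n : nat}.
Variable c : nat -> 'rV[R]_n.

Definition dyad_shift k (a : R) : 'rV[R]_n :=
  \sum_(0 <= j < k) (dyad j.+1 a - dyad j a) *: c j.

Lemma dyad_shift_dyad k a : 1 <= a -> dyad_shift k (dyad k a) = dyad_shift k a.
Proof.
by move=> a1; apply: eq_big_nat => j /andP[_ jk]; rewrite !dyad_dyad// ltnW.
Qed.

(** The shift depends on [a] only through [dyad M a], which is constant on each dyadic interval. *)
Lemma dyad_shift_simple M : is_simple (2 ^ M) (dyad_shift M).
Proof.
move=> l i; exists (dyad_shift M (1 + i%:R / 2 ^+ M) 0 l) => a.
rewrite in_itv natrX => ai.
have a1 : 1 <= a.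
  by case/andP: ai => + _; apply: le_trans; rewrite lerDl divr_ge0// exprn_ge0.
by rewrite -(dyad_shift_dyad M a1) (dyad_eq ai).
Qed.

End Translations.

(* In the direction [th], the digits from the [k]-th one on hardly move the
   sphere, and [th] and [c k] are transversal in the coordinate plane [i, j]. *)
Definition slow_path (R : realType) (n M : nat) (B L : R) (c : nat -> 'rV[R]_n) :=
  [/\ forall j, `|c j| <= B, c M = 0 &
    forall th, dot th th = 1 -> exists k (i j : 'I_n),
      [/\ (k <= M)%N, i != j /\ (forall l, l != i -> l != j -> c k 0 l = 0),
          1 <= `|minor i j th (c k)|, 2 ^- k <= L / M%:R &
          forall m, (k <= m <= M)%N ->
            `|1 + dot th (c m)| <= L / M%:R * (m - k).+1%:R]].

(** * From a slow path to slabs and shells *)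

Section SlowPathGeometry.
Context {R : realType} {n : nat}.
Variables (M : nat) (B L : R) (c : nat -> 'rV[R]_n).

(** In the shell estimate, 16 L comes from the first-order term, L from the squared radius error and
    4 n B^2 L from the squared length of the shift error. The slab estimate needs less. *)
Definition slab_const : R := 17 * L + 4 * n%:R * B ^+ 2 * L.

Lemma shift_tail_le k a : (k <= M)%N -> 1 <= a -> (forall j, `|c j| <= B) ->
  `|dyad_shift c M a - dyad_shift c k a| <= 2 * B * 2 ^- k.
Proof.
move=> kM a1 cB; rewrite /dyad_shift (big_cat_nat (leq0n k) kM)//= addrAC subrr add0r.
apply: le_trans (ler_norm_sum _ _ _) _.
apply: le_trans (_ : _ <= \sum_(k <= j < M) 2 ^- j * B) _.
  rewrite big_nat [leRHS]big_nat; apply: ler_sum => j _.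
  by rewrite normrZ ler_pM// dyad_diff.
rewrite -mulr_suml mulrAC ler_wpM2r ?(le_trans _ (cB 0%N))//.
by rewrite -{1}(subnKC kM) sum_inv_pow2.
Qed.

(* The last digits of [a] move the radius and the center almost coherently in
   the direction [th]. *)
Lemma shift_tail_dot_le k a th : (k <= M)%N -> 1 <= a -> c M = 0 -> 0 <= L ->
  (forall m, (k <= m <= M)%N -> `|1 + dot th (c m)| <= L / M%:R * (m - k).+1%:R) ->
  `|dot th (dyad_shift c M a - dyad_shift c k a) + (a - dyad k a)| <= 4 * (L / M%:R * 2 ^- k).
Proof.
move=> kM a1 cM L0 thc; rewrite /dyad_shift (big_cat_nat (leq0n k) kM)//= addrAC subrr add0r.
have -> : a - dyad k a = \sum_(k <= j < M) (dyad j.+1 a - dyad j a) + (a - dyad M a).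
  by rewrite telescope_sumr//; ring.
rewrite dot_sumr addrA -big_split/=.
(* As [c M] vanishes, the remainder beyond the last digit takes the form of one more summand, of
   index [M]. *)
have -> : a - dyad M a = (a - dyad M a) * (1 + dot th (c M)).
  by rewrite cM dot0r addr0 mulr1.
apply: le_trans (ler_normD _ _) _.
have LM : 0 <= L / M%:R by rewrite divr_ge0.
apply: le_trans (_ : _ <= L / M%:R *
  (\sum_(k <= j < M) 2 ^- j * (j - k).+1%:R + 2 ^- M * (M - k).+1%:R)) _.
  rewrite [leRHS]mulrDr; apply: lerD.
    apply: le_trans (ler_norm_sum _ _ _) _.
    rewrite mulr_sumr big_nat [leRHS]big_nat; apply: ler_sum => j /andP[kj jM].
    rewrite dotZr -[X in _ + X]mulr1 -mulrDr [dot _ _ + 1]addrC normrM mulrCA ler_pM ?dyad_diff//.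
    by rewrite thc// kj ltnW.
  rewrite normrM mulrCA ler_pM//; last by rewrite thc// kM leqnn.
  by rewrite ger0_norm ?subr_ge0 ?dyad_le// lerBlDl ltW// dyad_gt.
rewrite mulrCA ler_wpM2l//.
by have := @sum_inv_pow2_linear R k (M - k); rewrite subnKC.
Qed.

(** The direction [th] from the center of the sphere to [X] selects [k]. Replacing center and radius
    by their truncations to [k] digits changes the squared radius by O(2^-k / M): the first-order
    effect is bounded by [shift_tail_dot_le], and the second-order terms are O(4^-k), with 2^-k =
    O(1/M). *)
Lemma slow_path_slab_shell a X : 1 <= B -> 1 <= L -> 8 * B ^+ 2 * L <= M%:R ->
  slow_path M B L c -> 1 <= a < 2 -> translate (l2sphere a) (dyad_shift c M a) X ->
  exists k (i j : 'I_n) (q : 'I_(2 ^ k)) (b : bool),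
  [/\ (k <= M)%N, i != j, forall l, l != i -> l != j -> c k 0 l = 0 &
    slab_shell slab_const (2 + 2 * B) (dyad_shift c k (1 + q%:R / 2 ^+ k)) (c k) i j
      ((-1) ^+ b) (1 + q%:R / 2 ^+ k) M%:R^-1 (2 ^- k / M%:R) X].
Proof.
move=> B1 L1 BM [cB cM cth] a12 [Z Za XZ].
have /andP[a1 a2] := a12.
have a0 : 0 < a by apply: lt_le_trans a1.
pose th := a^-1 *: Z.
have ZZ : dot Z Z = a ^+ 2 by rewrite -Za l2normE sqr_sqrtr ?dotxx_ge0.
have th1 : dot th th = 1 by rewrite dotZl dotZr ZZ; field; rewrite gt_eqF.
have [k [i [j [kM [ij c0] min1 kL thc]]]] := cth _ th1.
have [q qa] := dyad_index k a12.
(* The bit records the sign of the minor, so that the signed minor is its absolute value. *)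
exists k, i, j, q, (minor i j (X - dyad_shift c k a) (c k) < 0).
split=> //; rewrite -qa; rewrite dyad_shift_dyad//.
set w := dyad_shift c M a - dyad_shift c k a.
have XY : X - dyad_shift c k a = a *: th + w.
  by rewrite -XZ /w scalerA divff ?gt_eqF// scale1r addrA.
have M0 : 0 < M%:R :> R.
  by apply: lt_le_trans BM; rewrite !mulr_gt0// ?exprn_gt0//; apply: lt_le_trans B1 || apply: lt_le_trans L1.
have := shift_tail_le kM a1 cB; rewrite -/w => wB.
have := shift_tail_dot_le kM a1 cM (le_trans ler01 L1) thc; rewrite -/w => wth.
clearbody th w.
set e := 2 ^- k in kL wB wth *; set eta := M%:R^-1 in kL wth *.
have e0 : 0 < e by rewrite invr_gt0 exprn_gt0.
have eta0 : 0 < eta by rewrite invr_gt0.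
have e1 : e <= 1 by rewrite invf_le1 ?exprn_gt0// exprn_ege1// ler1n.
have B2L : 8 * B ^+ 2 * L * eta <= 1 by rewrite ler_pdivrMr// mul1r.
have thn : `|th| <= 1 by apply: norm_le_dot => //; rewrite th1 expr1n.
set d := a - dyad k a in wth *.
have d0 : 0 <= d by rewrite subr_ge0 dyad_le.
have de : d <= e by rewrite lerBlDl ltW// dyad_gt.
have ad : dyad k a = a - d by rewrite /d opprB addrC subrK.
have ww : `|dot w w| <= n%:R * (2 * B * e) * (2 * B * e).
  by apply: le_trans (norm_dot_le _ _) _; rewrite ler_pM ?mulr_ge0// ler_wpM2l.
have cw : `|dot (c k) w| <= n%:R * B * (2 * B * e).
  by apply: le_trans (norm_dot_le _ _) _; rewrite ler_pM ?mulr_ge0// ler_wpM2l.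
have ee : e * e <= L * eta * e by rewrite ler_wpM2r// ltW.
have B0 : 0 <= n%:R * B ^+ 2 by rewrite mulr_ge0 ?sqr_ge0.
have nBe : n%:R * B ^+ 2 * e <= n%:R * B ^+ 2 * (L * eta) by rewrite ler_wpM2l.
have nBee : n%:R * B ^+ 2 * (e * e) <= n%:R * B ^+ 2 * (L * eta * e).
  by rewrite ler_wpM2l.
have dd : d ^+ 2 <= e * e by rewrite expr2 ler_pM.
have dd0 : 0 <= d ^+ 2 by rewrite sqr_ge0.
split; rewrite ?XY ?ad.
- have -> : dot (a *: th + w) (a *: th + w) - (a - d) ^+ 2 =
      2 * a * (dot th w + d) + (dot w w - d ^+ 2).
    by rewrite !(dotDl, dotDr, dotZl, dotZr) th1 (dotC w th); ring.
  apply: le_trans (ler_normD _ _) _.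
  have a4 : `|2 * a * (dot th w + d)| <= 4 * (4 * (L * eta * e)).
    by rewrite normrM ler_pM// ger0_norm; lra.
  have := ler_normB (dot w w) (d ^+ 2); rewrite (ger0_norm dd0) => wd.
  by rewrite /slab_const; lra.
- have -> : a - d + dot (c k) (a *: th + w) =
      a * (1 + dot th (c k)) + (dot (c k) w - d).
    by rewrite dotDr dotZr (dotC th); ring.
  apply: le_trans (ler_normD _ _) _.
  have a2L : `|a * (1 + dot th (c k))| <= 2 * (L * eta).
    rewrite normrM ler_pM//; first by rewrite ger0_norm; lra.
    by have := thc k; rewrite subnn mulr1; apply; rewrite leqnn.
  have := ler_normB (dot (c k) w) d; rewrite (ger0_norm d0) => wd.
  have := mulr_ge0 B0 (ltW (mulr_gt0 (lt_le_trans ltr01 L1) eta0)).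
  have := mulr_gt0 (lt_le_trans ltr01 L1) eta0.
  by rewrite /slab_const; lra.
- set Y := a *: th + w.
  have -> : (-1) ^+ (minor i j Y (c k) < 0)%R * minor i j Y (c k) =
      `|minor i j Y (c k)|.
    case: ltP => m0; first by rewrite expr1 mulN1r ltr0_norm.
    by rewrite expr0 mul1r ger0_norm.
  have -> : minor i j Y (c k) = a * minor i j th (c k) + minor i j w (c k).
    by rewrite /minor !mxE; ring.
  (* Together with [8 * B ^+ 2 * L <= M%:R] this makes the perturbation of the minor at most 1/2,
     while its main part is at least 1. *)
  have mw : `|minor i j w (c k)| <= 2 * (2 * B * e * B).
    apply: le_trans (ler_normB _ _) _; rewrite !normrM.
    have wc l l' : `|w 0 l| * `|c k 0 l'| <= 2 * B * e * B.
      by rewrite ler_pM// (le_trans (norm_coord_le _ _)).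
    by have := wc i j; have := wc j i; lra.
  have am : 1 <= `|a * minor i j th (c k)|.
    by rewrite normrM gtr0_norm// mulr_ege1.
  have B2 : 0 <= B ^+ 2 by rewrite sqr_ge0.
  have := ler_wpM2l B2 kL.
  have := lerB_normD (a * minor i j th (c k)) (minor i j w (c k)).
  by lra.
- apply: le_trans (ler_normD _ _) _; rewrite normrZ gtr0_norm//.
  have : a * `|th| <= 2 * 1 by rewrite ler_pM// ltW.
  have : B * e <= B by rewrite ler_piMr//; lra.
  by lra.
Qed.

End SlowPathGeometry.

(** * A piecewise linear path along the coordinate axes *)

Section Sweep.
Context {R : realType} {n : nat}.
Variables (A : R) (p : 'I_n -> 'I_n).
Implicit Types (s t u x y : R) (th : 'rV[R]_n).

Definition tent x : R := Num.max 0 (1 - `|x|).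

Lemma tent_ge0 x : 0 <= tent x.
Proof. by rewrite le_max lexx. Qed.

Lemma tent_le1 x : tent x <= 1.
Proof. by rewrite ge_max ler01 lerBlDr lerDl normr_ge0. Qed.

Lemma tent_eq0 x : 1 <= `|x| -> tent x = 0.
Proof. by move=> x1; apply/max_idPl; rewrite subr_le0. Qed.

Lemma tent_lipschitz x y : `|tent x - tent y| <= `|x - y|.
Proof.
have H a b : tent a <= tent b + `|a - b|.
  rewrite ge_max addr_ge0 ?tent_ge0//=; apply: le_trans (_ : 1 - `|b| + `|a - b| <= _).
    by have := ler_distD a b 0; rewrite !subr0 (distrC b a); lra.
  by rewrite lerD2r le_max lexx orbT.
by have := H x y; have := H y x; rewrite (distrC y x) ler_norml => *; apply/andP; split; lra.
Qed.

(* Near the parameters [3 i + 1], [3 i + 2], [3 i + 3] the path goes from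
   [A e_i] through [A e_(p i)] to [- A e_i]. *)
Definition sweep_loop (i : 'I_n) s : 'rV[R]_n :=
  tent (s - (3 * i%:R + 1)) *: 'e_i + tent (s - (3 * i%:R + 2)) *: 'e_(p i)
  - tent (s - (3 * i%:R + 3)) *: 'e_i.

Definition sweep s : 'rV[R]_n := A *: \sum_i sweep_loop i s.

Lemma dot_delta th i : dot th 'e_i = th 0 i.
Proof.
rewrite /dot (bigD1 i)//= big1 => [|j ji]; rewrite mxE eqxx ?eqxx ?mulr1 ?addr0//.
by rewrite (negbTE ji) mulr0.
Qed.

Lemma norm_delta_le1 i : `|'e_i : 'rV[R]_n| <= 1.
Proof. by apply/norm_row_leP => // j; rewrite mxE; case: andb; rewrite ?normr1 ?normr0. Qed.

Lemma sweep_norm_le s : 0 <= A -> `|sweep s| <= 3 * n%:R * A.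
Proof.
move=> A0; rewrite normrZ ger0_norm// mulrC ler_wpM2r//.
apply: le_trans (ler_norm_sum _ _ _) _.
apply: le_trans (_ : _ <= \sum_(i < n) 3) _.
  apply: ler_sum => i _; apply: le_trans (ler_normB _ _) _.
  have H t j : `|tent t *: 'e_j : 'rV[R]_n| <= 1.
    rewrite normrZ mulr_ile1 ?norm_delta_le1// ger0_norm ?tent_ge0 ?tent_le1//.
  apply: le_trans (lerD (ler_normD _ _) (lexx _)) _.
  by apply: le_trans (lerD (lerD (H _ _) (H _ _)) (H _ _)) _; lra.
by rewrite sumr_const card_ord -[leLHS]mulr_natr.
Qed.

Lemma dot_sweep_loop th i s : dot th (sweep_loop i s) =
  tent (s - (3 * i%:R + 1)) * th 0 i + tent (s - (3 * i%:R + 2)) * th 0 (p i)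
  - tent (s - (3 * i%:R + 3)) * th 0 i.
Proof. by rewrite /sweep_loop dotDr dotDr dotNr !dotZr !dot_delta. Qed.

Lemma dot_sweep_lipschitz th s t : 0 <= A -> `|th| <= 1 ->
  `|dot th (sweep s) - dot th (sweep t)| <= 3 * n%:R * A * `|s - t|.
Proof.
move=> A0 th1; rewrite !dotZr -mulrBr normrM ger0_norm//.
have -> : 3 * n%:R * A * `|s - t| = A * (3 * `|s - t| * n%:R) by ring.
rewrite ler_wpM2l//.
rewrite !dot_sumr -sumrB; apply: le_trans (ler_norm_sum _ _ _) _.
apply: le_trans (_ : _ <= \sum_(i < n) 3 * `|s - t|) _; last first.
  by rewrite sumr_const card_ord -[leLHS]mulr_natr.
apply: ler_sum => i _; rewrite !dot_sweep_loop.
have H a l : `|(tent (s - a) - tent (t - a)) * th 0 l| <= `|s - t|.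
  rewrite normrM -[leRHS]mulr1 ler_pM ?(le_trans (norm_coord_le _ _))//.
  by apply: le_trans (tent_lipschitz _ _) _; rewrite opprB addrA subrK.
have := H (3 * i%:R + 1) i; have := H (3 * i%:R + 2) (p i); have := H (3 * i%:R + 3) i.
set x := (_ * _); set y := (_ * _); set z := (_ * _) => hx hy hz.
rewrite (_ : _ - _ = z + y - x); last by rewrite /x /y /z; ring.
apply: le_trans (ler_normB _ _) _; apply: le_trans (lerD (ler_normD _ _) (lexx _)) _.
lra.
Qed.

Lemma sweep_end : sweep (3 * n%:R + 1) = 0.
Proof.
rewrite /sweep big1 ?scaler0// => i _.
have ni : i%:R + 1 <= n%:R :> R by rewrite natr1 ler_nat.
by rewrite /sweep_loop !tent_eq0 ?scale0r ?subr0 ?addr0// ger0_norm; lra.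
Qed.

(** Loop [j] vanishes outside [3j, 3j + 4], so only loop [i] survives on [3i + 1, 3i + 3]. There the
    path is a corner made of two segments, meeting at [A *: 'e_(p i)]. *)
Lemma sweep_eq (i : 'I_n) u : -1 <= u <= 1 ->
  sweep (3 * i%:R + 2 - u) = A *: (u *: 'e_i + (1 - `|u|) *: 'e_(p i)).
Proof.
move=> /andP[u1 u2]; congr (_ *: _); rewrite (bigD1 i)//= big1 ?addr0 => [|j ji].
  have -> : sweep_loop i (3 * i%:R + 2 - u) =
      (tent (1 - u) - tent (1 + u)) *: 'e_i + tent u *: 'e_(p i).
    rewrite /sweep_loop scalerBl.
    have -> : 3 * i%:R + 2 - u - (3 * i%:R + 1) = 1 - u by ring.
    have -> : 3 * i%:R + 2 - u - (3 * i%:R + 2) = - u by ring.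
    have -> : 3 * i%:R + 2 - u - (3 * i%:R + 3) = - (1 + u) by ring.
    by rewrite /tent !normrN addrAC.
  congr (_ *: _ + _ *: _); last by apply/max_idPr; rewrite subr_ge0 ler_norml; lra.
  rewrite /tent !ger0_norm; try lra.
  have [u0|u0] := leP 0 u.
    by rewrite (max_idPr _) ?(max_idPl _); lra.
  by rewrite (max_idPl _) ?(max_idPr _); lra.
have : (j < i)%N \/ (i < j)%N.
  by move: ji; rewrite -val_eqE neq_ltn => /orP.
rewrite /sweep_loop => -[]; rewrite -(ler_nat R) -natr1 => ij.
  by rewrite !tent_eq0 ?scale0r ?subr0 ?addr0// ger0_norm; lra.
by rewrite !tent_eq0 ?scale0r ?subr0 ?addr0// ler0_norm; lra.
Qed.

End Sweep.

(** * Crossing the critical hyperplane, and existence of slow paths *)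

Section SweepCrossing.
Context {R : realType}.

Lemma zero_on_segment (x y : R) : x <= 0 <= y ->
  exists2 t, 0 <= t <= 1 & (1 - t) * y + t * x = 0.
Proof.
move=> /andP[x0 y0]; have [yx|yx] := eqVneq (y - x) 0.
  by exists 0; rewrite ?lexx ?ler01//; lra.
have yx0 : 0 < y - x by rewrite lt_neqAle eq_sym yx/=; lra.
exists (y / (y - x)); last by field.
by rewrite divr_ge0 ?(ltW yx0)//= ler_pdivrMr//; lra.
Qed.

(** The expression is affine in [u] on each of [-1, 0] and [0, 1]. At the two ends it is [1 + a * x]
    and [1 - a * x], which have opposite signs in the weak sense as [1 <= |a * x|]; the sign at
    [u = 0] decides which segment contains a zero. *)
Lemma zero_on_corner (a x y : R) : 1 <= `|a * x| ->
  exists2 u, -1 <= u <= 1 & 1 + a * (u * x + (1 - `|u|) * y) = 0.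
Proof.
move=> ax; have [s s1 sx] : exists2 s : R, `|s| = 1 & 1 + a * (s * x) <= 0.
  have [ax0|ax0] := leP 0 (a * x).
    by exists (-1); rewrite ?normrN1//; rewrite ger0_norm// in ax; lra.
  by exists 1; rewrite ?normr1//; rewrite ltr0_norm// in ax; lra.
have sx' : 0 <= 1 + a * (- s * x) by lra.
have [y0|y0] := leP 0 (1 + a * y).
  have [|t /andP[t0 t1] tE] := @zero_on_segment (1 + a * (s * x)) (1 + a * y).
    by rewrite sx y0.
  have nt : `|t * s| = t by rewrite normrM s1 mulr1 ger0_norm.
  exists (t * s); last by rewrite nt -tE; ring.
  by rewrite -ler_norml nt.
have [|t /andP[t0 t1] tE] := @zero_on_segment (1 + a * y) (1 + a * (- s * x)).
  by rewrite sx' ltW.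
have nt : `|(1 - t) * - s| = 1 - t by rewrite normrM normrN s1 mulr1 ger0_norm//; lra.
exists ((1 - t) * - s); last by rewrite nt -tE; ring.
by rewrite -ler_norml nt; lra.
Qed.

(** The largest of the squared coordinates is at least their mean. *)
Lemma large_coord (n : nat) (th : 'rV[R]_n) : dot th th = 1 ->
  exists i, 1 <= n%:R * th 0 i ^+ 2.
Proof.
move=> th1; have [i0|] := pickP 'I_n; last first.
  move=> h; exfalso; move: th1; rewrite /dot big1 => [/eqP|i _].
    by rewrite eq_sym oner_eq0.
  by have := h i.
case: (@Order.TotalTheory.arg_maxP _ _ _ i0 xpredT (fun i => th 0 i ^+ 2)) => // i _ imax.
exists i; apply: le_trans (_ : dot th th <= _); first by rewrite th1.
rewrite mulr_natl -[X in _ *+ X]card_ord -sumr_const.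
by apply: ler_sum => j _; rewrite -expr2; exact: imax.
Qed.

(* The square of the minor is the Cauchy-Schwarz defect of the two plane
   vectors, and [a] is so large that it dominates the squared dot product. *)
Lemma corner_minor (a N x y u : R) : 1 <= N -> a = 10 * N -> 1 <= N * x ^+ 2 ->
  -1 <= u <= 1 -> `|1 + a * (u * x + (1 - `|u|) * y)| <= 1 ->
  1 <= `|x * (a * (1 - `|u|)) - y * (a * u)|.
Proof.
move=> N1 aN Nx u1 fu.
set v := 1 - `|u| in fu *; set d := a * (u * x + v * y) in fu *.
have uv : 1 <= 2 * (u ^+ 2 + v ^+ 2).
  have : `|u| + v = 1 by rewrite /v addrC subrK.
  have -> : u ^+ 2 = `|u| ^+ 2 by rewrite real_normK ?num_real.
  have := sqr_ge0 (`|u| - v); nra.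
rewrite -(@ler_sqr _ 1) ?nnegrE// expr1n real_normK ?num_real//.
have -> : (x * (a * v) - y * (a * u)) ^+ 2 =
    a ^+ 2 * (u ^+ 2 + v ^+ 2) * (x ^+ 2 + y ^+ 2) - d ^+ 2.
  by rewrite /d; ring.
have d2 : d ^+ 2 <= 4.
  move: fu; rewrite ler_norml => /andP[? ?]; nra.
have ax : 50 <= a ^+ 2 * (u ^+ 2 + v ^+ 2) * x ^+ 2.
  have -> : a ^+ 2 * (u ^+ 2 + v ^+ 2) * x ^+ 2 =
     50 * (N * (2 * (u ^+ 2 + v ^+ 2)) * (N * x ^+ 2)) by rewrite aN; ring.
  by rewrite ler_peMr// mulr_ege1// mulr_ege1.
have ay : 0 <= a ^+ 2 * (u ^+ 2 + v ^+ 2) * y ^+ 2.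
  by rewrite mulr_ge0 ?sqr_ge0// mulr_ge0 ?sqr_ge0// addr_ge0 ?sqr_ge0.
by rewrite mulrDr; lra.
Qed.

End SweepCrossing.

(** The sweep is sampled at equally spaced parameters from [- K] to [K], so the first half of the
    samples is idle and every crossing has index at least [M / 2]. For a unit vector [th],
    [1 + dot th] vanishes at some parameter [t] on a corner; [k] is a sample next to [t], and the
    Lipschitz bound gives the linear growth after it. *)
Lemma slow_path_exists (R : realType) (n : nat) : (2 <= n)%N ->
  exists B L : R, exists M0 : nat, [/\ 1 <= B, 1 <= L &
    forall M, (M0 <= M)%N -> exists c : nat -> 'rV[R]_n, slow_path M B L c].
Proof.
move=> n2.
have /choice[p pi] : forall i : 'I_n, exists j, j != i.
  move=> i; have [->|i0] := eqVneq i (Ordinal (ltnW n2)).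
    by exists (Ordinal n2); rewrite -val_eqE.
  by exists (Ordinal (ltnW n2)); rewrite eq_sym.
have n1 : 2 <= n%:R :> R by rewrite ler_nat.
(* The factor 10 is the one required by [corner_minor]; [K] is the parameter where the sweep has
   returned to 0. *)
pose A : R := 10 * n%:R; pose K : R := 3 * n%:R + 1.
have A20 : 20 <= A by rewrite /A; lra.
have A0 : 0 <= A by lra.
have K7 : 7 <= K by rewrite /K; lra.
pose B := 3 * n%:R * A; have B1 : 120 <= B by rewrite /B; nra.
pose L := B * (2 * K); have L2 : 2 <= L by rewrite /L; nra.
have L1 : 1 <= L by lra.
exists B, L, (Num.truncn L).+1; split => [||M ML]; [lra|by []|].
(* This gives both [step <= 1] and [L / M%:R <= 1], the latter being the bound that [corner_minor]
   asks for at the sample [k]. *)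
have {}ML : L <= M%:R.
  have := truncn_itv (le_trans ler01 L1) => /andP[_ /ltW/le_trans]; apply.
  by rewrite ler_nat.
have M0 : 0 < M%:R :> R by lra.
pose step := 2 * K / M%:R.
have step1 : step <= 1 by rewrite ler_pdivrMr// mul1r; apply: le_trans ML; rewrite /L; nra.
have step0 : 0 < step by rewrite divr_gt0//; lra.
have sM : step * M%:R = 2 * K by rewrite /step divfK ?gt_eqF.
have BL : B * step = L / M%:R by rewrite /step /L mulrA.
pose s (m : nat) := step * m%:R - K.
exists (fun m => sweep A p (s m)); split=> [m||th th1].
- exact: sweep_norm_le.
- have -> : s M = 3 * n%:R + 1 by rewrite /s sM /K; ring.
  exact: sweep_end.
have thn : `|th| <= 1 by apply: norm_le_dot => //; rewrite th1 expr1n.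
have [i thi] := large_coord th1.
have Ath : 1 <= `|A * th 0 i|.
  rewrite -(@ler_sqr _ 1) ?nnegrE// expr1n real_normK ?num_real// exprMn /A.
  have -> : (10 * n%:R) ^+ 2 * th 0 i ^+ 2 = 100 * n%:R * (n%:R * th 0 i ^+ 2) by ring.
  by rewrite mulr_ege1//; lra.
have dotE u : -1 <= u <= 1 -> dot th (sweep A p (3 * i%:R + 2 - u)) =
    A * (u * th 0 i + (1 - `|u|) * th 0 (p i)).
  by move=> u1; rewrite sweep_eq// dotZr dotDr !dotZr !dot_delta.
have [u u1 fu] := zero_on_corner (th 0 (p i)) Ath.
pose t := 3 * i%:R + 2 - u.
have ft : 1 + dot th (sweep A p t) = 0 by rewrite dotE.
have i0 : 0 <= i%:R :> R by [].
have iN : i%:R + 1 <= n%:R :> R by rewrite natr1 ler_nat.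
have [k [kt kr]] : exists k : nat, `|s k - t| <= step /\ 3 * i%:R + 1 <= s k <= 3 * i%:R + 3.
  have tK : 0 <= (t + K) / step.
    by rewrite divr_ge0 ?(ltW step0)// /t /K; case/andP: u1 => *; lra.
  have := truncn_itv tK; set k := Num.truncn _.
  rewrite ler_pdivlMr// ltr_pdivrMr// -natr1 => /andP[k1 k2].
  (* Rounding goes towards the vertex [3 * i%:R + 2], so that the sample stays on the same
     corner. *)
  case/andP: u1 => u1 u2; have [u0|u0] := leP 0 u.
    exists k.+1; split; rewrite /s -natr1; last by apply/andP; split; rewrite /t in k1 k2; lra.
    by rewrite ler_norml; apply/andP; split; lra.
  exists k; split; rewrite /s; last by apply/andP; split; rewrite /t in k1 k2; lra.
  by rewrite ler_norml; apply/andP; split; lra.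
have kM : (k <= M)%N.
  have : step * k%:R <= step * M%:R.
    by rewrite sM; case/andP: kr => _; rewrite /s /K; lra.
  by rewrite ler_pM2l// ler_nat.
have sK m : (k <= m)%N -> `|s m - t| <= step * (m - k).+1%:R.
  move=> km; have -> : s m - t = step * (m - k)%:R + (s k - t).
    by rewrite /s natrB//; ring.
  apply: le_trans (ler_normD _ _) _; rewrite -natr1 mulrDr mulr1 lerD//.
  by rewrite ger0_norm// mulr_ge0// ltW.
have lip m : (k <= m)%N ->
    `|1 + dot th (sweep A p (s m))| <= L / M%:R * (m - k).+1%:R.
  move=> km; rewrite -BL -mulrA.
  have -> : 1 + dot th (sweep A p (s m)) =
      dot th (sweep A p (s m)) - dot th (sweep A p t) by lra.
  apply: le_trans (dot_sweep_lipschitz _ _ _ A0 thn) _.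
  by rewrite ler_wpM2l ?sK// /B mulr_ge0// mulr_ge0.
pose v := 3 * i%:R + 2 - s k.
have v1 : -1 <= v <= 1 by rewrite /v; case/andP: kr => *; apply/andP; split; lra.
have sv : s k = 3 * i%:R + 2 - v by rewrite /v; ring.
have ip : i != p i by rewrite eq_sym.
exists k, i, (p i); split=> //.
- split=> // l li lp; rewrite sv sweep_eq// !mxE (negbTE li) (negbTE lp) /=.
  by rewrite !mulr0 addr0 mulr0.
- rewrite sv sweep_eq// /minor !mxE !eqxx (negbTE ip) eq_sym (negbTE ip) /=.
  rewrite !mulr0 !mulr1 addr0 add0r.
  apply: (@corner_minor _ A n%:R) => //; first by lra.
  rewrite -dotE// -sv; apply: le_trans (lip _ (leqnn k)) _.
  by rewrite subnn mulr1 ler_pdivrMr// mul1r.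
(* A positive [s k] means that [k] lies beyond the idle half. *)
- have Mk : M%:R <= 2 * k%:R :> R.
    have : step * M%:R <= step * (2 * k%:R).
      by rewrite sM; case/andP: kr => + _; rewrite /s; lra.
    by rewrite ler_pM2l.
  have k0 : 0 < k%:R :> R by lra.
  apply: le_trans (_ : k%:R^-1 <= _).
    by rewrite lef_pV2 ?posrE ?exprn_gt0// -natrX ler_nat ltnW// ltn_expl.
  rewrite ler_pdivlMr// ler_pdivrMl//; apply: le_trans Mk _.
  by rewrite mulrC ler_pM2l.
- by move=> m /andP[km _]; exact: lip.
Qed.

(** * Measurability of the union and the final count *)

Lemma measurable_simple_union (R : realType) (n N : nat) (V : R -> 'rV[R]_n) :
  (0 < N)%N -> is_simple N V ->
  measurable [set t : n.-tuple (measurableTypeR R) |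
    (\bigcup_(a in `[1%R : R, 2%R[) translate (l2sphere a) (V a)) (\row_i tnth t i)].
Proof.
move=> N0 sV; have N0R : 0 < N%:R :> R by rewrite ltr0n.
pose lo (i : nat) : R := 1 + i%:R / N%:R.
have VE (i : 'I_N) a : a \in `[lo i, lo i.+1[ -> V a = V (lo i).
  move=> ai; apply/rowP => k; have [c cP] := sV k i; rewrite !cP//.
  by rewrite in_itv/= lexx/= ltrD2l ltr_pM2r ?invr_gt0// ltr_nat.
pose g i (t : n.-tuple (measurableTypeR R)) : R := l2norm (\row_k tnth t k - V (lo i)).
(* As [V] is constant on each of the [N] intervals, the uncountable union is a finite union of
   half-open shells with fixed centers. *)
rewrite (_ : [set t | _] = \bigcup_(i in [set: 'I_N]) (g i @^-1` `[lo i, lo i.+1[)).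
  apply: fin_bigcup_measurable => // i _.
  rewrite -[X in measurable X]setTI.
  suff mg : measurable_fun setT (g i) by apply: mg => //; exact: measurable_itv.
  apply: (@measurableT_comp _ _ _ _ _ _ (@Num.sqrt R)).
    by apply: continuous_measurable_fun => x; exact: sqrt_continuous.
  apply: measurable_sum => k; apply: measurable_funX.
  under eq_fun do rewrite !mxE.
  by apply: measurable_funB => //; exact: measurable_tnth.
apply/seteqP; split=> [t [a a12 [Z Za tZ]]|t [i _ ti]].
  move: a12; rewrite /= in_itv/= => /andP[a1 a2].
  have aN : 0 <= N%:R * (a - 1) by rewrite mulr_ge0 ?subr_ge0// ltW.
  have iN : (Num.truncn (N%:R * (a - 1)) < N)%N.
    by rewrite truncn_lt_nat// gtr_pMr//; lra.
  have ai : a \in `[lo (Ordinal iN), lo (Ordinal iN).+1[.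
    have /andP[ia ai] := truncn_itv aN.
    by rewrite in_itv/= /lo -lerBrDl -ltrBlDl ler_pdivrMr// ltr_pdivlMr// [(a - 1) * _]mulrC ia.
  exists (Ordinal iN) => //=.
  by rewrite /g -tZ (VE _ _ ai) addrK (_ : l2norm Z = a).
exists (g i t) => /=.
  move: ti; rewrite /= !in_itv/= => /andP[t1 t2]; apply/andP; split.
    by apply: le_trans t1; rewrite lerDl divr_ge0.
  apply: lt_le_trans t2 _; rewrite /lo.
  have : i.+1%:R / N%:R <= 1 :> R by rewrite ler_pdivrMr// mul1r ler_nat.
  by lra.
exists (\row_k tnth t k - V (lo i)) => //.
by rewrite (VE i) ?subrK.
Qed.

(** One cube contains all the unshifted spheres; this settles the finitely many small [M]. *)
Lemma box_cover_concentric (R : realType) (n : nat) :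
  box_cover (\bigcup_(a in `[1%R : R, 2%R[) translate (l2sphere a) (0 : 'rV[R]_n)) (8 ^+ n).
Proof.
have -> : 8 = 2 * 4 :> R by lra.
have norm2 X : (\bigcup_(a in `[1%R : R, 2%R[) translate (l2sphere a) (0 : 'rV[R]_n)) X ->
    `|X| <= 2.
  move=> [a]; rewrite /= in_itv/= => /andP[a1 a2] [Z Za <-]; rewrite addr0.
  have {}Za : l2norm Z = a by [].
  apply: norm_le_dot => //; rewrite -(sqr_sqrtr (dotxx_ge0 Z)) -l2normE Za.
  by apply: lerXn2r; rewrite ?nnegrE//; lra.
apply: box_cover_diam => // X Y /norm2 X2 /norm2 Y2.
by apply: le_trans (ler_normB _ _) _; lra.
Qed.

(** For each [k] there are [2 ^ k] digit prefixes, n^2 pairs of coordinates and two signs, each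
    piece having a cover of volume at most D 2^-k / M^2. The powers of 2 cancel, and the
    [M.+1 <= 2 * M] values of [k] leave a bound of order 1/M. *)
Lemma box_cover_slow_path (R : realType) (n M : nat) (B L : R) (c : nat -> 'rV[R]_n) :
  (0 < M)%N -> 1 <= B -> 1 <= L -> 8 * B ^+ 2 * L <= M%:R -> slow_path M B L c ->
  let C := @slab_const R n B L in
  let D := (2 * C + 1) * (2 * (2 + 2 * B) + 1) ^+ n *
           (2 * @slab_shell_diam R n C (2 + 2 * B)) ^+ n in
  box_cover (\bigcup_(a in `[1%R : R, 2%R[) translate (l2sphere a) (dyad_shift c M a))
    (4 * n%:R ^+ 2 * D / M%:R).
Proof.
move=> M0 B1 L1 BM sc C D.
have M0R : 1 <= M%:R :> R by rewrite ler1n.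
have C1 : 1 <= C.
  by rewrite /C /slab_const; have : 0 <= 4 * n%:R * B ^+ 2 * L; [rewrite !mulr_ge0//; lra|lra].
have dd0 : 0 <= @slab_shell_diam R n C (2 + 2 * B).
  by rewrite /slab_shell_diam !(addr_ge0, mulr_ge0)//; lra.
have D0 : 0 <= D by rewrite /D !mulr_ge0 ?exprn_ge0//; lra.
pose F (k : nat) (t : 'I_n * 'I_n * bool * 'I_(2 ^ k)) : set 'rV[R]_n :=
  let: (i, j, b, q) := t in [set X |
    [/\ i != j, forall l, l != i -> l != j -> c k 0 l = 0 &
    slab_shell C (2 + 2 * B) (dyad_shift c k (1 + q%:R / 2 ^+ k)) (c k) i j
      ((-1) ^+ b) (1 + q%:R / 2 ^+ k) M%:R^-1 (2 ^- k / M%:R) X]].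
have coverF k t : box_cover (@F k t) (D * (M%:R^-1 * (2 ^- k / M%:R))).
  have e0 : 0 < 2 ^- k :> R by rewrite invr_gt0 exprn_gt0.
  have e1 : 2 ^- k <= 1 :> R by rewrite invf_le1 ?exprn_gt0// exprn_ege1// ler1n.
  have eta0 : 0 < M%:R^-1 :> R by rewrite invr_gt0; lra.
  move: t => [[[i j] b] q]; have [[ij c0]|h] :=
      pselect (i != j /\ forall l, l != i -> l != j -> c k 0 l = 0).
    apply: (box_cover_le _ (lexx _)); last first.
      apply: (@box_cover_slab_shell R n C (2 + 2 * B)
        (dyad_shift c k (1 + q%:R / 2 ^+ k)) (c k) i j ((-1) ^+ b)
        (1 + q%:R / 2 ^+ k)) => //.
      - lra.
      - by rewrite normrX normrN1 expr1n.
      - by case: sc => cB _ _; apply: le_trans (cB k) _; lra.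
      - exact: mulr_gt0.
      - by rewrite ler_piMl// ltW.
      - by rewrite invf_le1//; lra.
    by move=> X [].
  (* An inadmissible pair of coordinates yields the empty set. *)
  exists [::]; split=> //; first by move=> X [ij c0 _]; case: h.
  by rewrite big_nil mulr_ge0// ltW// !mulr_gt0.
apply: (@box_cover_le _ _ _ (\bigcup_(a in `[1%R : R, 2%R[)
  translate (l2sphere a) (dyad_shift c M a))
  (#|'I_M.+1|%:R * (2 * n%:R ^+ 2 * D / M%:R ^+ 2))) => //.
  rewrite card_ord.
  have M1 : M.+1%:R <= 2 * M%:R :> R by rewrite -natr1; lra.
  have -> : 4 * n%:R ^+ 2 * D / M%:R = (2 * M%:R) * (2 * n%:R ^+ 2 * D / M%:R ^+ 2).
    by field; rewrite gt_eqF//; lra.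
  by rewrite ler_wpM2r// divr_ge0 ?sqr_ge0// mulr_ge0// mulr_ge0// sqr_ge0.
apply: (@box_cover_union _ _ 'I_M.+1 (fun k : 'I_M.+1 => [set X | exists t, @F k t X])).
  move=> k.
  have -> : 2 * n%:R ^+ 2 * D / M%:R ^+ 2 =
      #|{: 'I_n * 'I_n * bool * 'I_(2 ^ k)}|%:R * (D * (M%:R^-1 * (2 ^- k / M%:R))).
    rewrite !card_prod !card_ord card_bool !natrM natrX; field.
    by rewrite !gt_eqF ?exprn_gt0//; lra.
  exact: box_cover_union (coverF k) _.
move=> X [a]; rewrite /= in_itv/= => a12 aX.
have [k [i [j [q [b [kM ij c0 sX]]]]]] := slow_path_slab_shell B1 L1 BM sc a12 aX.
have kM1 : (k < M.+1)%N by [].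
by exists (Ordinal kM1), (i, j, b, q).
Qed.

Theorem theorem5p8 (R : realType) (n : nat) (hn : (2 <= n)%N) :
  exists C : R, forall M : nat, (1 <= M)%N ->
    exists V : R -> 'rV[R]_n,
      is_simple (2 ^ M)%N V /\
      (vol (\bigcup_(a in `[1%R : R, 2%R[)
              translate (l2sphere a) (V a))
       <= (C / M%:R)%:E)%E.
Proof.
have [B [L [M0 [B1 L1 slowM]]]] := @slow_path_exists R n hn.
pose M1 := maxn M0 (Num.truncn (8 * B ^+ 2 * L)).+1.
pose C := @slab_const R n B L.
pose D := 4 * n%:R ^+ 2 * ((2 * C + 1) * (2 * (2 + 2 * B) + 1) ^+ n *
           (2 * @slab_shell_diam R n C (2 + 2 * B)) ^+ n).
(* The second entry serves [M < M1], where [V = 0] and [8 ^+ n <= 8 ^+ n * M1%:R / M%:R]. *)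
exists (Num.max D (8 ^+ n * M1%:R)) => M M_gt0.
have M0R : 0 < M%:R :> R by rewrite ltr0n.
have N0 : (0 < 2 ^ M)%N by rewrite expn_gt0.
have [M1M|MM1] := leqP M1 M.
  have [c sc] := slowM M (leq_trans (leq_maxl _ _) M1M).
  exists (dyad_shift c M); split; first exact: dyad_shift_simple.
  apply: vol_le_box_cover.
    by apply: measurable_simple_union N0 _; exact: dyad_shift_simple.
  apply: (box_cover_le (@subset_refl _ _)); last first.
    apply: (box_cover_slow_path _ B1 L1 _ sc) => //.
    have BL0 : 0 <= 8 * B ^+ 2 * L by rewrite !mulr_ge0 ?sqr_ge0//; lra.
    have /andP[_ /ltW/le_trans] := truncn_itv BL0; apply.
    by rewrite ler_nat (leq_trans (leq_maxr _ _) M1M).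
  by rewrite ler_wpM2r ?invr_ge0// le_max lexx.
exists (fun=> 0); split; first by move=> k i; exists 0 => a _; rewrite mxE.
apply: vol_le_box_cover.
  apply: measurable_simple_union N0 _.
  by move=> k i; exists 0 => a _; rewrite mxE.
apply: box_cover_le (@box_cover_concentric R n); first exact: subset_refl.
rewrite ler_pdivlMr// le_max; apply/orP; right.
by rewrite ler_wpM2l ?exprn_ge0// ler_nat ltnW.
Qed.
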